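(* For every $n \geq 1$ there exists a surjective map $\varphi : \mathcal{T}_n \to \mathrm{SP}_n$ such that for every $f \in \mathrm{SP}_n$, $$\sum_{T \in \varphi^{-1}(f)} 2^{\mathrm{fr}(T)} = 2^{\mathrm{ndf}(f)}.$$
   Context: $\mathcal{T}_n$ denotes the set of tableaux $T$ with $n$ columns and $2n$ rows containing $2n$ dots such that every row contains exactly one dot, every column contains exactly two dots, and if there is a dot in the box $(j,i)$ (intersection of the $j$-th column from the left and the $i$-th row from the bottom) then $j \leq i$. A dot of $T$ in a box $(j,i)$ with $i \geq 2n+1-j$ is called free, and $\mathrm{fr}(T)$ is the number of free dots of $T$. $\mathrm{SP}_n$ (surjective pistols) is the set of surjective maps $f : \{1,\dots,2n\} \to \{2,4,\dots,2n\}$ such that $f(j) \geq j$ for all $j$. For $f \in \mathrm{SP}_n$, an integer $j \in \{1,\dots,2n-2\}$ is a doubled fixed point of $f$ if there exists $j' < j$ with $f(j') = f(j) = j$ (so $2n$ is never a doubled fixed point). $\mathrm{ndf}(f)$ is the number of elements of $\{2,4,\dots,2n\}$ that are not doubled fixed points of $f$. *)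

(* Defs.v *)
From mathcomp Require Import all_boot.

Set Implicit Arguments.
Unset Strict Implicit.
Unset Printing Implicit Defensive.

(* Ordinals count from 0, the mathematics counts from 1: an index i : 'I_m
   (column, row, or argument of a pistol) stands for the integer i + 1. *)
Definition pos (m : nat) (i : 'I_m) : nat := i.+1.

(* The set {2, 4, ..., 2n} is indexed by 'I_n, with k standing for 2(k + 1). *)
Definition even_pos (n : nat) (k : 'I_n) : nat := (pos k).*2.

(* A box is a pair (column from the left, row from the bottom); a filling is
   the set of the boxes that contain a dot. *)
Definition filling (n : nat) := {set 'I_n * 'I_n.*2}.

Definition is_tableau (n : nat) (T : filling n) : bool :=
  [&& #|T| == n.*2,
      [forall i : 'I_n.*2, #|[set j : 'I_n | (j, i) \in T]| == 1],
      [forall j : 'I_n, #|[set i : 'I_n.*2 | (j, i) \in T]| == 2]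
    & [forall b in T, pos b.1 <= pos b.2]].

Definition tableau (n : nat) := {T : filling n | is_tableau T}.

Definition free_box (n : nat) (b : 'I_n * 'I_n.*2) : bool :=
  n.*2 + 1 - pos b.1 <= pos b.2.

Definition fr (n : nat) (T : tableau n) : nat :=
  #|[set b in val T | free_box b]|.

Definition is_surjective_pistol (n : nat) (f : {ffun 'I_n.*2 -> 'I_n}) : bool :=
  [forall k : 'I_n, exists j : 'I_n.*2, f j == k]
  && [forall j : 'I_n.*2, pos j <= even_pos (f j)].

Definition surjective_pistol (n : nat) :=
  {f : {ffun 'I_n.*2 -> 'I_n} | is_surjective_pistol f}.

Definition pistol_value (n : nat) (f : surjective_pistol n) (j : 'I_n.*2) : nat :=
  even_pos (val f j).

Definition doubled_fixed_point (n : nat) (f : surjective_pistol n) (p : nat) : bool :=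
  (1 <= p <= n.*2 - 2)
  && [exists j : 'I_n.*2, exists j' : 'I_n.*2,
        [&& pos j == p, pos j' < pos j,
            pistol_value f j' == p & pistol_value f j == p]].

Definition ndf (n : nat) (f : surjective_pistol n) : nat :=
  #|[set k : 'I_n | ~~ doubled_fixed_point f (even_pos k)]|.

(* Main.v *)
(** Put t for 2 and compare W = sum_T t^fr(T) with P = sum_f t^ndf(f).  If
    c (P - W) = (t - 2) Q with c > 0 and Q of nonnegative coefficients, then the
    powers 2^fr(T) can be packed exactly into bins of capacity 2^ndf(f):
    a term t^k of Q tells that a bin of size 2^(k+1) should be cut into two
    bins of size 2^k, and once Q is exhausted bins and items agree in number
    for each size.

    Tableaux are built column by column, from the last to the first.  Summing over
    the set of the top rows already used, only its size r matters, which gives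
    a linear recursion [tstep] on sequences.  Pistols are built value by value;
    only the number a of pending arguments matters, and the weight as a linear
    functional of x^(a-2) satisfies a recursion E(x) -> u(x+1)E(x+1) - u(x)E(x).
    After the substitution X = 2x, the iterated differences of E
    at X = 2 satisfy a linear recursion which coincides with [tstep] at t = 2 and
    exceeds it, entry by entry, by (t - 2) times a nonnegative quantity. *)
Require Import Defs.
From mathcomp Require Import all_boot all_order all_algebra ring zify.
Set Implicit Arguments.
Unset Strict Implicit.
Unset Printing Implicit Defensive.
Import GRing.Theory Num.Theory Order.TTheory.
Local Open Scope ring_scope.

(** * Comparison of the two linear recursions *)

Lemma mul2_bin2 i : (2 * 'C(i.+1, 2) = i.+1 * i)%N.
Proof. by rewrite bin2 mul2n halfK oddM /= andNb subn0. Qed.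

Section Differences.
Variables (R : comNzRingType) (t : R).
Implicit Type f : nat -> R.

Definition diff f (x : nat) : R := f x.+1 - f x.

Lemma iter_diffS k f x : iter k diff f x.+1 = iter k diff f x + iter k.+1 diff f x.
Proof. by rewrite iterS /diff; ring. Qed.

(* Four times u(x/2), where u(y) = (t y - t + 1) y. *)
Definition quad (x : nat) : R := (t * x%:R - 2 * t + 2) * x%:R.

(** Leibniz rule for differences: [quad] has degree 2 in its argument, so only three terms survive.
    Where [k.-1] or [k.-2] truncates, the coefficient vanishes. *)
Lemma iter_diff_quad k f x :
  iter k diff (fun y => quad y * f y) x =
  quad (x + k) * iter k diff f x
  + k%:R * (t * (2 * x%:R + 2 * k%:R - 3) + 2) * iter k.-1 diff f x
  + k%:R * (k%:R - 1) * t * iter k.-2 diff f x.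
Proof.
elim: k x => [|k IHk] x; first by rewrite addn0 /=; ring.
rewrite iterS {1}/diff !IHk /quad.
by case: k {IHk} => [|[|k]] /=; rewrite /diff; ring.
Qed.

Definition dstep f (x : nat) : R := quad x.+2 * f x.+2 - quad x * f x.

(** At the point 2 every coefficient is a polynomial in t and k with nonnegative coefficients; this
    is why the differences are taken there. *)
Lemma iter_diff_dstep k f :
  iter k diff (dstep f) 2%N =
  (t * (k%:R + 2) + 2) * (k%:R + 4) * iter k.+2 diff f 2%N
  + (2 * (t * (k%:R + 1) + 2) * (k%:R + 3)
     + (k%:R + 2) * (t * (2 * k%:R + 5) + 2)) * iter k.+1 diff f 2%N
  + (k%:R + 1) * (5 * t * k%:R + 8 * t + 4) * iter k diff f 2%N
  + 2 * k%:R * (k%:R + 1) * t * iter k.-1 diff f 2%N.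
Proof.
(* A shift by two minus the identity is twice the difference plus the second difference. *)
have E x : iter k diff (dstep f) x =
    2 * iter k.+1 diff (fun y => quad y * f y) x
    + iter k.+2 diff (fun y => quad y * f y) x.
  elim: k x => [|k IHk] x; first by rewrite /= /dstep /diff; ring.
  by rewrite iterS {1}/diff !IHk (iter_diffS k.+1) (iter_diffS k.+2); ring.
rewrite E !iter_diff_quad /quad.
by case: k {E} => [|k] /=; rewrite /diff; ring.
Qed.


(** At k = 0 the binomial is zero, so the truncated index [k.-1] is harmless. *)
Definition weighted_pairs (q : nat -> R) k : R := 'C(k.+1, 2)%:R * q k.-1.

Definition tstep (q : nat -> R) k : R :=
  let p := weighted_pairs q in
  t * (p k + 2 * p k.+1 + p k.+2) + (p k.+1 + 2 * p k.+2 + p k.+3).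

Lemma mul4_tstep q k : 4 * tstep q k =
  2 * (k%:R + 1) * k%:R * t * q k.-1
  + 2 * (k%:R + 2) * (k%:R + 1) * (2 * t + 1) * q k
  + 2 * (k%:R + 3) * (k%:R + 2) * (t + 2) * q k.+1
  + 2 * (k%:R + 4) * (k%:R + 3) * q k.+2.
Proof.
have bin2E i : 2 * 'C(i.+1, 2)%:R = (i%:R + 1) * i%:R :> R.
  by rewrite -natrM mul2_bin2 natrM -natr1.
rewrite /tstep /weighted_pairs /=.
transitivity (2 * t * (2 * 'C(k.+1, 2)%:R * q k.-1
    + 2 * (2 * 'C(k.+2, 2)%:R) * q k + 2 * 'C(k.+3, 2)%:R * q k.+1)
  + 2 * (2 * 'C(k.+2, 2)%:R * q k + 2 * (2 * 'C(k.+3, 2)%:R) * q k.+1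
    + 2 * 'C(k.+4, 2)%:R * q k.+2)); first by ring.
by rewrite !bin2E; ring.
Qed.

End Differences.

(** * Polynomials with nonnegative coefficients *)

Definition nonneg_poly (p : {poly int}) := forall i, 0 <= p`_i.

Lemma nonneg_polyD p q : nonneg_poly p -> nonneg_poly q -> nonneg_poly (p + q).
Proof. by move=> p_ge0 q_ge0 i; rewrite coefD addr_ge0. Qed.

Lemma nonneg_polyM p q : nonneg_poly p -> nonneg_poly q -> nonneg_poly (p * q).
Proof.
by move=> p_ge0 q_ge0 i; rewrite coefM sumr_ge0 // => j _; rewrite mulr_ge0.
Qed.

Lemma nonneg_polyX : nonneg_poly 'X.
Proof. by move=> i; rewrite coefX ler0n. Qed.

Lemma nonneg_poly_nat n : nonneg_poly n%:R.
Proof. by move=> i; rewrite -polyC_natr coefC; case: ifP => // _; rewrite ler0n. Qed.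

Lemma nonneg_poly0 : nonneg_poly 0.
Proof. exact: (nonneg_poly_nat 0). Qed.

Lemma nonneg_poly1 : nonneg_poly 1.
Proof. exact: (nonneg_poly_nat 1). Qed.

Ltac prove_nonneg_poly := repeat (first
  [ assumption | apply: nonneg_polyX | apply: nonneg_poly1
  | apply: nonneg_poly_nat | apply: nonneg_polyD | apply: nonneg_polyM ]).

Definition pistol_diffs m k : {poly int} :=
  iter k (@diff _) (iter m (dstep 'X) (fun=> 'X)) 2%N.

Definition tableau_sums m : nat -> {poly int} :=
  iter m (tstep 'X) (fun k => if k == 0%N then 'X else 0).

Lemma pistol_diffs0 k : pistol_diffs 0 k = if k == 0%N then 'X else 0.
Proof.
case: k => [|k] //; rewrite /pistol_diffs; elim: k 2%N => [|k IHk] x.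
  by rewrite /= /diff /= subrr.
by rewrite iterS {1}/diff !IHk  subrr.
Qed.

Lemma nonneg_pistol_diffs m k : nonneg_poly (pistol_diffs m k).
Proof.
elim: m k => [|m IHm] k; last first.
  rewrite /pistol_diffs iterS iter_diff_dstep -!/(pistol_diffs _ _).
  have [IH0 IH1] := (IHm k.-1, IHm k); have [IH2 IH3] := (IHm k.+1, IHm k.+2).
  by prove_nonneg_poly.
rewrite pistol_diffs0; case: eqP => _; first exact: nonneg_polyX.
exact: nonneg_poly0.
Qed.

(* By [iter_diff_dstep] and [mul4_tstep] the coefficients of the two recursions
   differ by ('X - 2) times 0, (k+1)k, 2k^2+7k+4 and (k+4)(k+2). *)
Lemma tableau_sums_refine m k : exists2 Q, nonneg_poly Q &
  pistol_diffs m k - 4 ^+ m * tableau_sums m k = ('X - 2) * Q.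
Proof.
elim: m k => [|m IHm] k.
  exists 0; first exact: nonneg_poly0.
  by rewrite mulr0 expr0 mul1r pistol_diffs0 subrr.
have g_ge0 := nonneg_pistol_diffs m.
have [[Q0 Q0_ge0 E0] [Q1 Q1_ge0 E1]] := (IHm k.-1, IHm k).
have [[Q2 Q2_ge0 E2] [Q3 Q3_ge0 E3]] := (IHm k.+1, IHm k.+2).
have [g1 g2] := (g_ge0 k, g_ge0 k.+1); have g3 := g_ge0 k.+2.
(* The first four terms apply the tableau recursion to the earlier quotients; the last three apply
   the excess of the pistol recursion to [pistol_diffs m]. *)
exists (2 * (k%:R + 1) * k%:R * 'X * Q0
  + 2 * (k%:R + 2) * (k%:R + 1) * (2 * 'X + 1) * Q1
  + 2 * (k%:R + 3) * (k%:R + 2) * ('X + 2) * Q2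
  + 2 * (k%:R + 4) * (k%:R + 3) * Q3
  + (k%:R + 1) * k%:R * pistol_diffs m k
  + (2 * k%:R * k%:R + 7 * k%:R + 4) * pistol_diffs m k.+1
  + (k%:R + 4) * (k%:R + 2) * pistol_diffs m k.+2); first by prove_nonneg_poly.
rewrite exprSr -mulrA /tableau_sums iterS mul4_tstep -!/(tableau_sums _ _).
rewrite {1}/pistol_diffs iterS iter_diff_dstep -!/(pistol_diffs _ _).
transitivity (2 * (k%:R + 1) * k%:R * 'X * (('X - 2) * Q0)
  + 2 * (k%:R + 2) * (k%:R + 1) * (2 * 'X + 1) * (('X - 2) * Q1)
  + 2 * (k%:R + 3) * (k%:R + 2) * ('X + 2) * (('X - 2) * Q2)
  + 2 * (k%:R + 4) * (k%:R + 3) * (('X - 2) * Q3)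
  + ('X - 2) * ((k%:R + 1) * k%:R * pistol_diffs m k
  + (2 * k%:R * k%:R + 7 * k%:R + 4) * pistol_diffs m k.+1
  + (k%:R + 4) * (k%:R + 2) * pistol_diffs m k.+2)); last by ring.
by rewrite -E0 -E1 -E2 -E3; ring.
Qed.

(** * Packing powers of two *)

Section Packing.
Variables (I J : finType) (a : I -> nat).

(** An entry (j, k) of [B] is a piece of size 2^k cut from bin j. Each item fills one whole piece of
    its own size. *)
Lemma equal_packing (j0 : J) (s : seq I) (B : seq (J * nat)) :
  uniq s ->
  (forall k, count (fun i => a i == k) s = count (fun x => x.2 == k) B) ->
  exists phi : I -> J, forall j,
    (\sum_(i <- s | phi i == j) 2 ^ a i = \sum_(x <- B | x.1 == j) 2 ^ x.2)%N.
Proof.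
elim: s B => [|i s IHs] B /=.
  move=> _ cntB; exists (fun=> j0) => j.
  case: B cntB => [|x B] cntB; first by rewrite !big_nil.
  by have := cntB x.2; rewrite /= eqxx.
case/andP=> i_notin s_uniq cntB.
have /hasP[x xB /eqP x2] : has (fun x => x.2 == a i) B.
  by rewrite has_count -cntB eqxx.
have /permP perm_x := perm_to_rem xB.
have [|phi phiE] := IHs (rem x B) s_uniq.
  by move=> k; have := cntB k; rewrite perm_x /= x2 => /addnI.
exists (fun i' => if i' == i then x.1 else phi i') => j.
rewrite (perm_big _ (perm_to_rem xB)) !big_cons eqxx x2 -phiE.
have -> : (\sum_(i' <- s | (if i' == i then x.1 else phi i') == j) 2 ^ a i' =
           \sum_(i' <- s | phi i' == j) 2 ^ a i')%N.
  rewrite big_seq_cond [RHS]big_seq_cond; apply: eq_bigl => i'.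
  by case: (i' =P i) => // ->; rewrite (negPf i_notin).
by case: ifP.
Qed.

Lemma coef_sum_Xn (T : Type) (s : seq T) (b : T -> nat) k :
  (\sum_(x <- s) 'X^(b x) : {poly int})`_k = (count (fun x => b x == k) s)%:R.
Proof.
rewrite coef_sum; elim: s => [|x s IHs]; first by rewrite big_nil.
by rewrite big_cons IHs coefXn /= natrD eq_sym.
Qed.

(* Cut a bin of size 2^(k+1), where k is the degree of Q, and subtract c X^k
   from Q: the leading coefficient of Q is a positive multiple of c. *)
Lemma packing_seq (j0 : J) (c : nat) (Q : {poly int}) (B : seq (J * nat)) :
  (0 < c)%N -> nonneg_poly Q ->
  c%:R * (\sum_(x <- B) 'X^(x.2) - \sum_i 'X^(a i)) = ('X - 2) * Q ->
  exists phi : I -> J, forall j,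
    (\sum_(i | phi i == j) 2 ^ a i = \sum_(x <- B | x.1 == j) 2 ^ x.2)%N.
Proof.
move=> c_gt0.
(* A cut keeps the total size and adds one piece. No piece is smaller than 1, so this measure
   decreases strictly. *)
have [N] := ubnP (\sum_(x <- B) 2 ^ x.2 - size B)%N.
elim: N Q B => // N IHN Q B ltN Q_ge0 defQ.
have coefE k : c%:R * ((count (fun x => x.2 == k) B)%:R
      - (count (fun i => a i == k) (index_enum I))%:R) = (('X - 2) * Q)`_k.
  rewrite -defQ -!coef_sum_Xn -coefB -polyC_natr coefCM.
  by rewrite natz.
have [Q0 | Q_neq0] := eqVneq Q 0.
  apply: equal_packing => //; first exact: index_enum_uniq.
  move=> k; apply/eqP; rewrite -(eqr_nat int) eq_sym -subr_eq0.
  have := coefE k; rewrite Q0 mulr0 coef0 => /eqP; rewrite mulf_eq0.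
  by rewrite pnatr_eq0 -leqn0 leqNgt c_gt0.
set k := (size Q).-1.
have Qk_gt0 : 0 < Q`_k by rewrite lt_def Q_ge0 andbT -lead_coefE lead_coef_eq0.
have := coefE k.+1.
rewrite mulrBl coefB coefXM /= -polyC_natr coefCM.
have -> : Q`_k.+1 = 0.
  by rewrite nth_default // /k prednK // size_poly_gt0.
rewrite mulr0 subr0 => coefk.
(* The coefficient of X^(k+1) in (X - 2) Q is the leading coefficient of Q; its positivity forces
   more pieces than items of size 2^(k+1). *)
have [x xB /eqP x2] : exists2 x, x \in B & x.2 == k.+1.
  apply/hasP; rewrite has_count lt0n; apply/eqP=> cnt0.
  by move: Qk_gt0; rewrite -coefk cnt0 sub0r mulrN oppr_gt0 ltNge mulr_ge0 ?ler0n.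
have c_le : (c%:R <= Q`_k).
  rewrite -coefk; move: Qk_gt0; rewrite -coefk.
  move: (_ - _) => z; case: z => z; last by rewrite pmulr_rgt0 // ltr0n.
  by rewrite pmulr_rgt0 ?ltr0n // => z_gt0; rewrite ler_peMr ?ler0n // -gtz0_ge1.
have [s permB] : exists s : seq (J * nat), perm_eq B (x :: s).
  by exists (rem x B); apply: perm_to_rem.
have [|||phi phiE] := IHN (Q - c%:R * 'X^k) [:: (x.1, k), (x.1, k) & s].
- move: ltN; rewrite !big_cons (perm_size permB) /=.
  rewrite (perm_big _ permB) big_cons x2 /= expnS.
  have : (0 < 2 ^ k)%N by rewrite expn_gt0.
  have : (size (s) <= \sum_(j <- s) 2 ^ j.2)%N.
    by rewrite -sum1_size leq_sum // => y _; rewrite expn_gt0.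
  by lia.
- move=> i; rewrite coefB -polyC_natr coefCM coefXn.
  by case: eqP => [->|_]; rewrite ?mulr1 ?mulr0 ?subr0 ?subr_ge0 // natz.
- rewrite [RHS]mulrBr -defQ (perm_big _ permB) !big_cons x2 /=.
  by rewrite exprS; ring.
exists phi => j; rewrite phiE (perm_big _ permB) !big_cons x2 /= expnS.
by case: ifP => [-> | -> //]; rewrite mul2n -addnn addnA.
Qed.

Lemma packing (j0 : J) (b : J -> nat) (c : nat) (Q : {poly int}) :
  (0 < c)%N -> nonneg_poly Q ->
  c%:R * (\sum_j 'X^(b j) - \sum_i 'X^(a i)) = ('X - 2) * Q ->
  exists phi : I -> J, forall j, (\sum_(i | phi i == j) 2 ^ a i = 2 ^ b j)%N.
Proof.
move=> c_gt0 Q_ge0 defQ.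
have [|phi phiE] := @packing_seq j0 c Q [seq (j, b j) | j <- index_enum J] c_gt0 Q_ge0.
  by rewrite big_map.
by exists phi => j; rewrite phiE big_map /= big_pred1_eq.
Qed.

End Packing.

(** * Weighted maps and their fibers *)

Section WeightedMaps.
Variables (R : comNzRingType) (T : finType) (w : nat -> {set T} -> R).

(** A sum over maps from A to the values [cs], built fiber by fiber; the base case discards choices
    that leave elements of A unassigned. *)
Fixpoint wsum (cs : seq nat) (A : {set T}) : R :=
  if cs is c :: cs' then \sum_(Z : {set T} | Z \subset A) w c Z * wsum cs' (A :\: Z)
  else (A == set0)%:R.

Lemma wsum_cons c cs A :
  wsum (c :: cs) A = \sum_(Z : {set T} | Z \subset A) w c Z * wsum cs (A :\: Z).
Proof. by []. Qed.

(** The map [g0] freezes g outside A. Once the fiber Z of c is chosen, g is frozen to c on Z and the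
    induction continues on the rest of A. *)
Lemma sum_prod_fibers_on n (cs : seq nat) (A : {set T}) (g0 : {ffun T -> 'I_n}) :
  uniq cs -> all (fun c => c < n)%N cs ->
  \sum_(g : {ffun T -> 'I_n} |
       [forall i, if i \in A then val (g i) \in cs else g i == g0 i])
     \prod_(c <- cs) w c [set i in A | val (g i) == c] = wsum cs A.
Proof.
elim: cs A g0 => [|c cs IHcs] A g0 /=.
  move=> _ _; have [-> | [i iA]] := set_0Vmem A.
    rewrite eqxx (big_pred1 g0) ?big_nil // => g /=.
    apply/forallP/eqP => [gE | -> i]; last by rewrite inE.
    by apply/ffunP=> i; have := gE i; rewrite inE => /eqP.
  rewrite big_pred0 => [|g]; last first.
    by apply/forallP=> /(_ i); rewrite iA.
  by case: eqP => // A0; rewrite A0 inE in iA.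
case/andP=> c_notin cs_uniq /andP[lt_cn cs_lt].
rewrite (partition_big (fun g : {ffun T -> 'I_n} => [set i in A | val (g i) == c])
  (fun Z : {set T} => Z \subset A)) /=; last first.
  by move=> g _; apply/subsetP=> i; rewrite inE => /andP[].
apply: eq_bigr => Z /subsetP ZA.
pose g1 := [ffun i => if i \in Z then Ordinal lt_cn else g0 i].
rewrite -(IHcs _ g1) // big_distrr; apply: eq_big => [g | g /andP[_ /eqP defZ]].
  apply/andP/forallP => [[/forallP gP /eqP defZ] i | gP].
    have := gP i; rewrite -defZ !inE !ffunE -defZ !inE.
    case: (i \in A) => //=; case: (val (g i) =P c) => //= gi _.
    by apply/eqP/val_inj.
  have defZ : [set i in A | val (g i) == c] = Z.
    apply/setP=> i; rewrite inE; have := gP i; rewrite !inE ffunE.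
    case iZ: (i \in Z); first by rewrite ZA //= => /eqP ->; rewrite /= eqxx.
    case: (i \in A) => //= gi; apply/eqP=> gic.
    by rewrite gic (negPf c_notin) in gi.
  split; last by rewrite defZ.
  apply/forallP=> i; have := gP i; rewrite !inE ffunE.
  case iZ: (i \in Z); first by rewrite ZA //= => /eqP ->; rewrite /= eqxx.
  by case: (i \in A) => //= gi; rewrite gi orbT.
rewrite big_cons defZ; congr (_ * _); apply: eq_big_seq => c' c'_in.
congr (w c' _); apply/setP=> i; rewrite -defZ !inE.
case: (i \in A) => //=; case: (val (g i) =P c') => [-> | _]; rewrite ?andbF //.
by rewrite !andbT; apply/esym/negP=> /eqP c'c; rewrite -c'c c'_in in c_notin.
Qed.

(** The order of the values is left open: pistols use the increasing one, tableaux the decreasing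
    one. *)
Lemma sum_prod_fibers n (cs : seq nat) : perm_eq cs (iota 0 n.+1) ->
  \sum_(g : {ffun T -> 'I_n.+1}) \prod_(c < n.+1) w c [set i | g i == c] =
  wsum cs setT.
Proof.
move=> cs_perm.
have mem_cs c : (c \in cs) = (c < n.+1)%N.
  by rewrite (perm_mem cs_perm) mem_iota add0n.
rewrite -(sum_prod_fibers_on setT [ffun=> ord0 : 'I_n.+1]).
- apply: eq_big => [g | g _].
    by apply/esym/forallP=> i; rewrite inE mem_cs ltn_ord.
  rewrite (perm_big _ cs_perm) /=.
  have -> : 0%N :: iota 1 n = index_iota 0 n.+1 by rewrite /index_iota subn0.
  by rewrite big_mkord; apply: eq_bigr => c _; congr (w c _); apply/setP=> i; rewrite !inE.
- by rewrite (perm_uniq cs_perm) iota_uniq.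
- by apply/allP=> c; rewrite mem_cs.
Qed.

End WeightedMaps.

(** * Recursion for pistols *)

Section Pistols.
Variables (R : comNzRingType) (t : R).

(* The map E(x) -> u(x+1)E(x+1) - u(x)E(x) with u(x) = (t x - t + 1) x. *)
Definition shift_step (f : nat -> R) (x : nat) : R :=
  (t * x%:R + 1) * x.+1%:R * f x.+1 - (t * x%:R - t + 1) * x%:R * f x.

Lemma iter_dstep_double m x :
  iter m (dstep t) (fun=> t) x.*2 = 4 ^+ m * iter m shift_step (fun=> t) x.
Proof.
elim: m x => [|m IHm] x; first by rewrite mul1r.
rewrite !iterS /dstep -doubleS !IHm /shift_step /quad exprS -!mul2n -natr1; ring.
Qed.

Lemma eq_iter_shift_step m (f g : nat -> R) :
  f =1 g -> iter m shift_step f =1 iter m shift_step g.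
Proof.
by move=> fg; elim: m => [|m IHm] x //; rewrite !iterS /shift_step !IHm.
Qed.

Lemma iter_shift_step_sum (I : finType) (P : pred I) (c : I -> R)
    (f : I -> nat -> R) m x :
  iter m shift_step (fun y => \sum_(i | P i) c i * f i y) x =
  \sum_(i | P i) c i * iter m shift_step (f i) x.
Proof.
elim: m x => [|m IHm] x //; rewrite iterS /shift_step !IHm !big_distrr -sumrB /=.
by apply: eq_bigr => i _; rewrite /shift_step; ring.
Qed.

Lemma sum_subsets_expr (T : finType) (A : {set T}) (x : R) :
  \sum_(Z : {set T} | Z \subset A) x ^+ (#|A| - #|Z|) = (x + 1) ^+ #|A|.
Proof.
rewrite exprDn.
rewrite (partition_big (fun Z : {set T} => inord #|Z| : 'I_#|A|.+1) predT) //=.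
apply: eq_bigr => k _; rewrite expr1n mulr1 -cards_draws -sumr_const.
rewrite (eq_bigl (fun Z : {set T} => Z \in [set Z : {set T} | Z \subset A & #|Z| == k])).
  by apply: eq_bigr => Z; rewrite inE => /andP[_ /eqP ->].
move=> Z; rewrite inE; case ZA: (Z \subset A) => //=.
by rewrite -val_eqE /= inordK // ltnS subset_leq_card.
Qed.

(** Give every nonempty Z the factor t, then remove t - 1 times the sum over the Z that contain p
    and another element. Both sums come from the binomial theorem. *)
Lemma sum_marked_subsets (T : finType) (A : {set T}) (p : T) (x : R) : p \in A ->
  \sum_(Z : {set T} | (Z \subset A) && (Z != set0))
     (if (p \in Z) && (1 < #|Z|)%N then 1 else t) * x ^+ (#|A| - #|Z|) =
  t * (x + 1) ^+ #|A| - (t - 1) * (x + 1) ^+ #|A|.-1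
  - t * x ^+ #|A| + (t - 1) * x ^+ #|A|.-1.
Proof.
move=> pA; have A_gt0 : (0 < #|A|)%N by apply/card_gt0P; exists p.
have cardAp : #|A| = #|A :\ p|.+1 by rewrite (cardsD1 p A) pA.
have sum_notin : \sum_(Z : {set T} | (Z \subset A) && (p \notin Z)) x ^+ (#|A| - #|Z|)
    = x * (x + 1) ^+ #|A|.-1.
  rewrite cardAp -sum_subsets_expr big_distrr /=; apply: eq_big => Z.
    by rewrite subsetD1.
  case/andP=> ZA pZ; rewrite -exprS subSn // subset_leq_card //.
  by rewrite subsetD1 ZA pZ.
have sum_in : \sum_(Z : {set T} | (Z \subset A) && (p \in Z)) x ^+ (#|A| - #|Z|)
    = (x + 1) ^+ #|A|.-1.
  have := sum_subsets_expr A x.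
  rewrite (bigID (fun Z : {set T} => p \in Z)) /= sum_notin => /(canRL (addrK _)) ->.
  by rewrite -{1}(prednK A_gt0) exprS; ring.
have sum_pair : \sum_(Z : {set T} | [&& Z \subset A, p \in Z & (1 < #|Z|)%N])
    x ^+ (#|A| - #|Z|) = (x + 1) ^+ #|A|.-1 - x ^+ #|A|.-1.
  apply/(canRL (addrK _)); rewrite -sum_in [RHS](bigD1 [set p]) /=; last first.
    by rewrite sub1set pA set11.
  rewrite cards1 subn1 addrC; congr (_ + _); apply: eq_bigl => Z.
  rewrite -andbA; case: (Z \subset A) => //=; case pZ: (p \in Z) => //=.
  rewrite eq_sym eqEcard sub1set pZ cards1 /= -ltnNge //.
rewrite (eq_bigr (fun Z : {set T} => t * x ^+ (#|A| - #|Z|)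
   - (t - 1) * (if (p \in Z) && (1 < #|Z|)%N then x ^+ (#|A| - #|Z|) else 0)));
  last by move=> Z _; case: ifP => _; ring.
rewrite sumrB -!big_distrr /= -big_mkcondr /=.
have -> : \sum_(Z : {set T} | (Z \subset A) && (Z != set0)) x ^+ (#|A| - #|Z|)
    = (x + 1) ^+ #|A| - x ^+ #|A|.
  apply/(canRL (addrK _)); rewrite -sum_subsets_expr [RHS](bigD1 set0) /= ?sub0set //.
  by rewrite cards0 subn0 addrC.
have -> : \sum_(Z : {set T} | (Z \subset A) && (Z != set0) && ((p \in Z) && (1 < #|Z|)%N))
    x ^+ (#|A| - #|Z|) = (x + 1) ^+ #|A|.-1 - x ^+ #|A|.-1.
  rewrite -sum_pair; apply: eq_bigl => Z; rewrite -andbA; congr (_ && _).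
  case pZ: (p \in Z); rewrite ?andbF //=; case: eqP => // Z0.
  by rewrite Z0 inE in pZ.
by ring.
Qed.

Variable n : nat.

(** Z stands for the fiber of the value 2(k+1). It is nonempty by surjectivity and bounded by f(j)
    >= j; the factor is 1 at a doubled fixed point. *)
Definition pistol_weight (k : nat) (Z : {set 'I_n.*2}) : R :=
  if (Z != set0) && [forall i in Z, (i < k.*2.+2)%N] then
    if [&& k.+1 < n, [exists i in Z, val i == k.*2.+1] & 1 < #|Z|]%N then 1 else t
  else 0.

(** The pending arguments are those below 2k+2, say a of them. A fiber of size z removes z, and two
    new arguments become admissible, so the next exponent a - z + 2 - 2 is a - z. Summing over
    fibers turns x^(a-2) into its image under [shift_step]. *)
Lemma wsum_pistol_weight m k (A : {set 'I_n.*2}) :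
  (k + m.+1 = n)%N -> (forall i : 'I_n.*2, k.*2 <= i -> i \in A)%N ->
  wsum pistol_weight (iota k m.+1) A =
  iter m shift_step
    (fun x => t * x%:R ^+ (#|[set i in A | i < k.*2.+2]| - 2)%N) 1%N.
Proof.
elim: m k A => [|m IHm] k A kn sub_A.
  have n_k : n = k.+1 by rewrite -kn addn1.
  (* The last value must take all the remaining arguments, and 2n is never a doubled fixed point,
     whence the factor t. *)
  rewrite -[iota k 1]/[:: k] wsum_cons (bigD1 A) //= setDv eqxx mulr1.
  rewrite [X in _ + X]big1 ?addr0 => [|Z /andP[ZA Z_neqA]]; last first.
    rewrite setD_eq0; case AZ: (A \subset Z); last by rewrite mulr0.
    by rewrite eqEsubset ZA AZ in Z_neqA.
  have lt_k : (k.*2 < n.*2)%N by rewrite n_k doubleS.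
  have nk_lt : (k.+1 < n)%N = false by rewrite {1}n_k ltnn.
  rewrite /pistol_weight nk_lt /= expr1n mulr1 ifT //; apply/andP; split.
    by apply/set0Pn; exists (Ordinal lt_k); apply: sub_A.
  by apply/forall_inP=> i _; rewrite (leq_trans (ltn_ord i)) // n_k doubleS.
set B := [set i in A | _].
have lt_k : (k.*2.+3 < n.*2)%N by rewrite -kn; lia.
have lt_k2 : (k.*2.+2 < n.*2)%N by apply: ltnW.
have lt_k1 : (k.*2.+1 < n.*2)%N by apply: ltnW.
have lt_k0 : (k.*2 < n.*2)%N by apply: ltnW.
pose p := Ordinal lt_k1.
have pB : p \in B by rewrite inE sub_A //= ltnS leqnSn.
(* The arguments 2k and 2k+1 are still pending, so the exponent [#|B| - 2] is not truncated. *)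
have B_gt1 : (1 < #|B|)%N.
  rewrite (cardsD1 p) pB ltnS; apply/card_gt0P; exists (Ordinal lt_k0).
  by rewrite !inE sub_A //= -val_eqE /= ltnS leqW // andbT neq_ltn leqnn.
transitivity (\sum_(Z : {set 'I_n.*2} | (Z \subset B) && (Z != set0))
   (if (p \in Z) && (1 < #|Z|)%N then 1 else t)
   * iter m shift_step (fun x => t * x%:R ^+ (#|B| - #|Z|)) 1%N).
  rewrite -[iota k m.+2]/(k :: iota k.+1 m.+1) wsum_cons.
  move: (iota k.+1 m.+1) (IHm k.+1) => cs IHcs; rewrite (bigID (fun Z : {set 'I_n.*2} =>
    (Z != set0) && [forall i in Z, (i < k.*2.+2)%N])) /=.
  rewrite [X in _ + X]big1 ?addr0 => [|Z /andP[_ /negPf Zbad]]; last first.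
    by rewrite /pistol_weight Zbad mul0r.
  have subB (Z : {set 'I_n.*2}) :
      (Z \subset B) = (Z \subset A) && [forall i in Z, (i < k.*2.+2)%N].
    apply/subsetP/andP => [ZB | [/subsetP ZA /forall_inP Zk] i iZ].
      split; first by apply/subsetP=> i /ZB; rewrite inE => /andP[].
      by apply/forall_inP=> i /ZB; rewrite inE => /andP[].
    by rewrite inE ZA ?Zk.
  apply: eq_big => [Z | Z /and3P[ZA Z0 Zk]]; first by rewrite subB andbAC andbA.
  congr (_ * _).
    have lt_kn : (k.+1 < n)%N by rewrite -kn; lia.
    rewrite /pistol_weight Z0 Zk lt_kn /=.
    congr (if _ && _ then _ else _); apply/exists_inP/idP => [[i iZ /eqP ik]|pZ].
      by rewrite (_ : p = i) //; apply/val_inj.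
    by exists p.
  rewrite IHcs ?addSnnS // => [|i lt_ki]; last first.
    rewrite inE sub_A ?andbT; last by apply: leq_trans lt_ki; rewrite leq_double.
    apply/negP=> /(forall_inP Zk); rewrite -doubleS ltnNge; by rewrite lt_ki.
  apply: eq_iter_shift_step => x; congr (t * _ ^+ _).
  have ZB : Z \subset B by rewrite subB ZA Zk.
  have -> : [set i in A :\: Z | (i < k.+1.*2.+2)%N] =
      Ordinal lt_k |: (Ordinal lt_k2 |: (B :\: Z)).
    apply/setP=> i; rewrite !inE -!val_eqE /=.
    have iA : (k.*2.+2 <= i -> i \in A)%N by move=> le_ki; apply: sub_A; lia.
    have iZ : (k.*2.+2 <= i -> i \notin Z)%N.
      by move=> le_ki; apply/negP=> /(forall_inP Zk); lia.
    case: (leqP k.*2.+2 i) => le_ki.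
      rewrite iA ?iZ //=; lia.
    rewrite !andbT; case: (i \in Z); case: (i \in A) => /=; lia.
  rewrite !cardsU1 !inE -!val_eqE /= !ltnn ltnNge leqnSn !andbF /=.
  rewrite (_ : (k.*2.+3 == k.*2.+2) = false) /=; last by rewrite eqn_leq ltnn.
  by rewrite cardsD (setIidPr ZB) !add1n subn2.
rewrite -iter_shift_step_sum iterSr; apply: eq_iter_shift_step => x.
transitivity (t * (\sum_(Z : {set 'I_n.*2} | (Z \subset B) && (Z != set0))
     (if (p \in Z) && (1 < #|Z|)%N then 1 else t) * x%:R ^+ (#|B| - #|Z|))).
  by rewrite big_distrr; apply: eq_bigr => Z _ /=; ring.
rewrite (sum_marked_subsets _ pB) /shift_step -natr1.
case: #|B| B_gt1 => [|[|b]] // _; rewrite !subSS subn0 /=.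
by rewrite !exprS; ring.
Qed.

End Pistols.

(** * Recursion for tableaux *)

Section Tableaux.
Variables (R : comNzRingType) (t : R) (n : nat).
Implicit Types A K L : {set 'I_n.*2}.

(* Column c (counted from 0) is free exactly in the rows of [top c.+1]. *)
Definition top (j : nat) : {set 'I_n.*2} := [set i : 'I_n.*2 | n.*2 <= i + j]%N.

Lemma top0 : top 0 = set0.
Proof. by apply/setP=> i; rewrite !inE addn0 leqNgt ltn_ord. Qed.

Lemma topS j (lt_j : (n.*2 - j.+1 < n.*2)%N) : top j.+1 = Ordinal lt_j |: top j.
Proof. by apply/setP=> i; rewrite !inE -val_eqE /=; lia. Qed.

Lemma card_top j : (j <= n.*2)%N -> #|top j| = j.
Proof.
elim: j => [|j IHj] le_j; first by rewrite top0 cards0.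
have lt_j : (n.*2 - j.+1 < n.*2)%N by lia.
rewrite (topS lt_j) cardsU1 IHj; last exact: ltnW.
by rewrite inE /= (_ : _ <= _ = false)%N //; lia.
Qed.

Lemma card_low j : (j <= n.*2)%N -> #|[set i : 'I_n.*2 | i < j]%N| = j.
Proof.
move=> le_j; rewrite (_ : [set _ | _] = ~: top (n.*2 - j)).
  by rewrite cardsCs setCK card_top ?card_ord; lia.
by apply/setP=> i; rewrite !inE; lia.
Qed.

Definition tableau_weight (c : nat) (Z : {set 'I_n.*2}) : R :=
  if (#|Z| == 2%N) && [forall i in Z, (c <= i)%N] then t ^+ #|Z :&: top c.+1| else 0.

(* Weighted number of ways to fill the first j columns when K is the set of the
   top j rows used by later columns; L is K together with the free rows used by
   column j, whose other dots go to #|K|.+1 available non-free rows. *)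
Fixpoint completions (j : nat) (K : {set 'I_n.*2}) : R :=
  if j is j'.+1 then
    \sum_(L : {set 'I_n.*2} | [&& K \subset L, L \subset top j & #|L| <= #|K|.+2]%N)
      t ^+ (#|L| - #|K|) * 'C(#|K|.+1, #|K|.+2 - #|L|)%:R
        * completions j' (L :&: top j')
  else 1.

(** The free dots are forced to be L minus K; the others lie in the set [N] of available non-free
    rows from j on. Of the 2(j+1) available rows, j+1-|K| are free and j are too low, which leaves
    |K|+1 in [N]. *)
Lemma card_column_choices j A L :
  (j < n)%N -> (forall i : 'I_n.*2, i < j -> i \in A)%N -> #|A| = j.+1.*2 ->
  let K := top j.+1 :\: A in
  K \subset L -> L \subset top j.+1 -> (#|L| <= #|K|.+2)%N ->
  #|[set Z : {set 'I_n.*2} | [&& Z \subset A, #|Z| == 2%N,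
       [forall i in Z, (j <= i)%N] & K :|: Z :&: top j.+1 == L]]|
    = 'C(#|K|.+1, #|K|.+2 - #|L|).
Proof.
move=> lt_jn low_A cardA K KL L_top leL.
have lt_top (i : 'I_n.*2) : i \in top j.+1 -> (j < i)%N by rewrite inE; lia.
pose N := [set i in A | (j <= i)%N && (i \notin top j.+1)].
have cardN : #|N| = #|K|.+1.
  have -> : N = (A :\: top j.+1) :\: [set i : 'I_n.*2 | i < j]%N.
    by apply/setP=> i; rewrite !inE -leqNgt; case: (i \in A); rewrite ?andbF ?andbT.
  have lowA : (A :\: top j.+1) :&: [set i : 'I_n.*2 | i < j]%N = [set i : 'I_n.*2 | i < j]%N.
    apply/setIidPr/subsetP=> i; rewrite [in X in X -> _]inE => lt_ij.
    by rewrite in_setD low_A // andbT; apply/negP=> /lt_top; lia.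
  rewrite cardsD lowA card_low; last by lia.
  have := cardsID (top j.+1) A; have := cardsID A (top j.+1).
  by rewrite setIC -/K card_top ?cardA; lia.
rewrite -cardN -cards_draws.
have cardLK : #|L :\: K| = (#|L| - #|K|)%N by rewrite cardsD (setIidPr KL).
have LK i : i \in L :\: K -> (i \in A) && (i \in top j.+1).
  rewrite !in_setD => /andP[iK iL]; have iT := subsetP L_top _ iL.
  by move: iK; rewrite iT andbT negbK => ->.
have NLK (Y : {set 'I_n.*2}) : Y \subset N -> [disjoint Y & L :\: K].
  move=> /subsetP YN; rewrite -setI_eq0; apply/eqP/setP=> i; rewrite inE in_set0.
  apply/negP=> /andP[/YN iN /LK /andP[_ iT]].
  by move: iN; rewrite inE iT !andbF.
rewrite -[RHS](card_in_imset (f := fun Y : {set 'I_n.*2} => Y :|: (L :\: K))); last first.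
  move=> Y Y'; rewrite inE => /andP[YN _]; rewrite inE => /andP[YN' _] eqY.
  have Yeq (X : {set 'I_n.*2}) : [disjoint X & L :\: K] -> X = (X :|: (L :\: K)) :\: (L :\: K).
    by move=> dX; rewrite setDUl setDv setU0; apply/esym/setDidPl.
  by rewrite (Yeq Y (NLK _ YN)) (Yeq Y' (NLK _ YN')) eqY.
apply: eq_card => Z; rewrite inE; apply/and4P/imsetP.
  case=> /subsetP ZA /eqP cardZ /forall_inP Zj /eqP defL.
  have ZT : Z :&: top j.+1 = L :\: K.
    apply/setP=> i; rewrite -defL !inE; case iZ: (i \in Z) => //=.
      by rewrite ZA //= orbF andbT.
    by rewrite orbF andNb.
  exists (Z :\: top j.+1); last by rewrite -ZT setUC setID.
  rewrite inE; apply/andP; split.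
    by apply/subsetP=> i; rewrite in_setD => /andP[iT iZ]; rewrite in_set ZA // Zj.
  have := cardsID (top j.+1) Z; have := subset_leq_card KL.
  by rewrite cardZ ZT cardLK => le_KL cardE; apply/eqP; lia.
case=> Y; rewrite inE => /andP[YN /eqP cardY] ->.
have dY := NLK _ YN; move/subsetP: YN => YN; split.
- by apply/subsetP=> i; rewrite in_setU => /orP[/YN|/LK/andP[]] //; rewrite inE => /andP[].
- rewrite cardsU disjoint_setI0 // cards0 subn0 cardY cardLK.
  by have := subset_leq_card KL; lia.
- apply/forall_inP=> i; rewrite in_setU => /orP[/YN|/LK/andP[_ /lt_top /ltnW]] //.
  by rewrite inE => /and3P[].
apply/eqP/setP=> i; rewrite in_setU in_setI in_setU in_setD.
case iL: (i \in L).
  by rewrite (subsetP L_top _ iL) andbT; case: (i \in K); rewrite ?orbT.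
have iK : i \in K = false by apply/negP=> /(subsetP KL); rewrite iL.
rewrite iK andbF orbF /=; apply/negP=> /andP[/YN]; rewrite inE => /and3P[_ _ /negPf -> //].
Qed.

Lemma rev_iotaS j : rev (iota 0 j.+1) = j :: rev (iota 0 j).
Proof. by rewrite -addn1 iotaD rev_cat. Qed.

(** A is the set of rows still empty when j columns remain. Grouping the dots Z of a column by the
    set L of used free rows makes the sum depend on A only through [top j :\: A]. *)
Lemma wsum_tableau_weight j A :
  (j <= n)%N -> (forall i : 'I_n.*2, i.+1 < j -> i \in A)%N -> #|A| = j.*2 ->
  wsum tableau_weight (rev (iota 0 j)) A = completions j (top j :\: A).
Proof.
elim: j A => [|j IHj] A le_jn low_A cardA.
  by rewrite /= (_ : A = set0) ?eqxx //; apply: cards0_eq.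
rewrite rev_iotaS wsum_cons; set cs := rev _ in IHj *.
rewrite (bigID (fun Z : {set 'I_n.*2} => (#|Z| == 2%N) && [forall i in Z, (j <= i)%N])) /=.
rewrite [X in _ + X]big1 ?addr0 => [|Z /andP[_ /negPf Zbad]]; last first.
  by rewrite /tableau_weight Zbad mul0r.
set K := top j.+1 :\: A.
have dK (Z : {set 'I_n.*2}) : Z \subset A -> #|K :|: Z :&: top j.+1| = (#|K| + #|Z :&: top j.+1|)%N.
  move=> /subsetP ZA; rewrite cardsU -[RHS]subn0; congr (_ - _)%N.
  apply/eqP; rewrite cards_eq0; apply/eqP/setP=> i; rewrite !inE.
  by case iZ: (i \in Z); rewrite ?andbF // ZA.
rewrite (partition_big (fun Z : {set 'I_n.*2} => K :|: Z :&: top j.+1)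
  (fun L => [&& K \subset L, L \subset top j.+1 & #|L| <= #|K|.+2]%N)) /=; last first.
  move=> Z /and3P[ZA /eqP cardZ _]; rewrite subsetUl subUset subsetDl subsetIr /=.
  by rewrite dK // -addn2 leq_add2l -cardZ subset_leq_card // subsetIl.
apply: eq_bigr => L /and3P[KL LT leL].
have low_A' (i : 'I_n.*2) : (i < j)%N -> i \in A by apply: low_A.
transitivity (\sum_(Z in [set Z : {set 'I_n.*2} | [&& Z \subset A, #|Z| == 2%N,
       [forall i in Z, (j <= i)%N] & K :|: Z :&: top j.+1 == L]])
    t ^+ (#|L| - #|K|) * completions j (L :&: top j)); last first.
  by rewrite sumr_const card_column_choices // -mulr_natr; ring.
apply: eq_big => [Z | Z /andP[/and3P[ZA Z2 Zj] /eqP defL]].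
  by rewrite inE -!andbA.
rewrite /tableau_weight Z2 Zj /= -defL dK // addKn IHj.
- congr (_ * completions j _); apply/setP=> i; rewrite !inE.
  case iZ: (i \in Z); case iA: (i \in A) => //=; rewrite ?andbT ?andbF ?orbF //.
  + by lia.
  + by move/subsetP: ZA => /(_ _ iZ); rewrite iA.
  + by lia.
- exact: ltnW.
- move=> i lt_ij; rewrite inE low_A ?andbT; last by apply: ltn_trans lt_ij _.
  by apply/negP=> /(forall_inP Zj); lia.
- by rewrite cardsD (setIidPr ZA) cardA (eqP Z2); lia.
Qed.

(** The factor t^r combines with t^(|L|-r) from the recursion into t^|L|, which depends on L
    alone. *)
Definition completion_sum j r : R :=
  \sum_(K : {set 'I_n.*2} | (K \subset top j) && (#|K| == r)) t ^+ r * completions j K.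

Definition raised_completion_sum j r : R :=
  \sum_(L : {set 'I_n.*2} | (L \subset top j.+1) && (#|L| == r))
     t ^+ r * completions j (L :&: top j).

(** Split by whether L contains the lowest row of [top j.+1]: intersecting with [top j] forgets this
    row and leaves one factor t. *)
Lemma raised_completion_sumE j r : (j < n)%N ->
  raised_completion_sum j r =
  completion_sum j r + (if r is r'.+1 then t * completion_sum j r' else 0).
Proof.
move=> lt_jn; have lt_j : (n.*2 - j.+1 < n.*2)%N by lia.
pose o := Ordinal lt_j.
have o_notin : o \notin top j by rewrite inE /=; lia.
have topD : top j = top j.+1 :\ o by rewrite (topS lt_j) -/o setU1K.
rewrite /raised_completion_sum (bigID (fun L : {set 'I_n.*2} => o \in L)) /= addrC.
congr (_ + _).
  apply: eq_big => [L | L /andP[/andP[LT _] oL]].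
    by rewrite topD subsetD1 andbAC.
  by rewrite (setIidPl _) // topD subsetD1 LT oL.
case: r => [|r].
  rewrite big_pred0 // => L; rewrite cards_eq0.
  by case: eqP => [->|]; rewrite ?inE ?andbF.
rewrite (reindex_onto (fun K => o |: K) (fun L => L :\ o)) => [|L /andP[_ oL]]; last first.
  by rewrite setD1K.
rewrite /completion_sum big_distrr; apply: eq_big => [K | K /andP[/andP[/andP[KT _] _] /eqP KE]] /=.
  rewrite setU11 andbT cardsU1 topD subsetD1.
  case oK: (o \in K) => /=.
    rewrite andbF /=; apply/negbTE/negP=> /andP[_ /eqP KE].
    by move: oK; rewrite -KE !inE eqxx.
  rewrite setU1K ?oK // eqxx !andbT add1n eqSS subUset sub1set.
  by rewrite (topS lt_j) -/o setU11.
rewrite exprS mulrA; congr (_ * completions j _).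
have oK : o \notin K by rewrite -KE !inE eqxx.
have KT' : K \subset top j.
  by rewrite topD subsetD1 oK andbT (subset_trans _ KT) // subsetU1.
rewrite setIUl (setIidPl KT') (_ : _ :&: _ = set0) ?set0U //.
by apply/eqP; rewrite setI_eq0 disjoints1.
Qed.

(** Exchange the sums over K and L: each L contains C(|L|, r) sets K of size r, and |L| is r, r+1 or
    r+2. *)
Lemma completion_sumS j r :
  completion_sum j.+1 r =
  'C(r.+1, 2)%:R * raised_completion_sum j r
  + r.+1%:R ^+ 2 * raised_completion_sum j r.+1
  + 'C(r.+2, 2)%:R * raised_completion_sum j r.+2.
Proof.
rewrite /completion_sum /=.
under eq_bigr do rewrite big_distrr /=.
rewrite (exchange_big_dep (fun L : {set 'I_n.*2} =>
  (L \subset top j.+1) && (r <= #|L| <= r.+2)%N)) /=; last first.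
  move=> K L /andP[_ /eqP <-] /and3P[KL -> ->].
  by rewrite subset_leq_card.
transitivity (\sum_(L : {set 'I_n.*2} | (L \subset top j.+1) && (r <= #|L| <= r.+2)%N)
  'C(r.+1, r.+2 - #|L|)%:R * 'C(#|L|, r)%:R * (t ^+ #|L| * completions j (L :&: top j))).
  apply: eq_bigr => L /and3P[LT le_rL leL].
  rewrite [LHS](eq_big (fun K : {set 'I_n.*2} => K \in [set K : {set 'I_n.*2} | K \subset L & #|K| == r])
    (fun=> 'C(r.+1, r.+2 - #|L|)%:R * (t ^+ #|L| * completions j (L :&: top j)))).
  - by rewrite sumr_const cards_draws -mulr_natr; ring.
  - move=> K; rewrite inE LT /=; case: eqP => [-> | _]; rewrite ?andbF //= leL !andbT.
    by apply/andP/idP => [[] // | KL]; rewrite KL (subset_trans KL).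
  move=> K /andP[/andP[_ /eqP ->] _].
  have -> : t ^+ #|L| = t ^+ r * t ^+ (#|L| - r) by rewrite -exprD subnKC.
  by ring.
rewrite (bigID (fun L : {set 'I_n.*2} => #|L| == r)) /= -addrA; congr (_ + _).
  rewrite /raised_completion_sum big_distrr; apply: eq_big => [L | L /andP[_ /eqP ->]].
    by rewrite -andbA; congr (_ && _); move: #|L| => m; apply/idP/idP; lia.
  by rewrite binn mulr1 (_ : r.+2 - r = 2)%N //; lia.
rewrite (bigID (fun L : {set 'I_n.*2} => #|L| == r.+1)) /=; congr (_ + _).
  rewrite /raised_completion_sum big_distrr; apply: eq_big => [L | L /andP[_ /eqP ->]].
    by rewrite -!andbA; congr (_ && _); move: #|L| => m; apply/idP/idP; lia.
  by rewrite subSS subSnn bin1 binSn expr2.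
rewrite /raised_completion_sum big_distrr; apply: eq_big => [L | L].
  by rewrite -!andbA; congr (_ && _); move: #|L| => m; apply/idP/idP; lia.
rewrite -!andbA => /and5P[_ le_rL leL ne0 ne1].
have -> : #|L| = r.+2.
  by move: le_rL leL ne0 ne1; move: #|L| => m; lia.
by rewrite subnn bin0 mul1r -bin_sub ?leqW // (_ : r.+2 - r = 2)%N //; lia.
Qed.

Definition paired_sums j k : R :=
  raised_completion_sum j k.+1 + raised_completion_sum j k.+2.

(** The middle coefficient (r+1)^2 is C(r+1,2) + C(r+2,2), so the three terms group into two
    consecutive pairs. *)
Lemma completion_sum_weighted_pairs j r :
  completion_sum j.+1 r =
  weighted_pairs (paired_sums j) r + weighted_pairs (paired_sums j) r.+1.
Proof.
have sqE : r.+1%:R ^+ 2 = 'C(r.+1, 2)%:R + 'C(r.+2, 2)%:R :> R.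
  rewrite -natrD -natrX; congr (_%:R).
  by rewrite [X in (_ + X)%N]binS bin1 addnA addnn -mul2n mul2_bin2 -mulnn mulnSr.
rewrite completion_sumS sqE /weighted_pairs /paired_sums /=.
case: r sqE => [|r] _; last by rewrite /=; ring.
by rewrite ['C(1, 2)]bin_small //=; ring.
Qed.

Lemma paired_sumsS j : (j.+1 < n)%N ->
  paired_sums j.+1 =1 tstep t (paired_sums j).
Proof.
move=> lt_jn k; rewrite /paired_sums !raised_completion_sumE //.
by rewrite !completion_sum_weighted_pairs /tstep; ring.
Qed.

Lemma paired_sums0 k : (0 < n)%N -> paired_sums 0 k = if k == 0%N then t else 0.
Proof.
move=> n_gt0; have csum0 r : completion_sum 0 r = (r == 0%N)%:R.
  rewrite /completion_sum top0; case: r => [|r]; last first.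
    rewrite big_pred0 // => K; apply/negbTE/negP; rewrite subset0.
    by case/andP=> /eqP ->; rewrite cards0.
  rewrite (big_pred1 set0) ?mulr1 // => K /=.
  by rewrite subset0 cards_eq0 andbb.
rewrite /paired_sums !raised_completion_sumE // !csum0.
by case: k => [|k] /=; ring.
Qed.

Lemma paired_sumsE j : (j < n)%N ->
  paired_sums j =1 iter j (tstep t) (fun k => if k == 0%N then t else 0).
Proof.
elim: j => [|j IHj] lt_jn k; first exact: paired_sums0.
rewrite paired_sumsS // iterS /tstep /weighted_pairs !IHj //; exact: ltnW.
Qed.

Lemma completion_sum_set0 j : completion_sum j 0 = completions j set0.
Proof.
rewrite /completion_sum (big_pred1 set0) ?mul1r // => K /=.
by rewrite cards_eq0; case: eqP => [->|]; rewrite ?sub0set ?andbF.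
Qed.

End Tableaux.

(** * Generating functions *)

Section GeneratingFunctions.
Variables (R : comNzRingType) (t : R).

(** With one dot per row, a tableau is the graph of a map from rows to columns. *)
Definition graph_filling n (g : {ffun 'I_n.*2 -> 'I_n}) : filling n :=
  [set b : 'I_n * 'I_n.*2 | g b.2 == b.1].

Lemma is_tableau_graph n (g : {ffun 'I_n.*2 -> 'I_n}) :
  is_tableau (graph_filling g) =
  [forall c : 'I_n, (#|[set i | g i == c]| == 2)
     && [forall i in [set i | g i == c], (c <= i)%N]].
Proof.
rewrite /is_tableau.
have -> : #|graph_filling g| == n.*2.
  rewrite (_ : graph_filling g = [set (g i, i) | i in setT]).
    by rewrite card_imset ?cardsT ?card_ord // => i j [].
  apply/setP=> [[c i]]; rewrite inE /=; apply/eqP/imsetP => [<- | [j _ [-> ->]]] //.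
  by exists i.
have -> : [forall i, #|[set j | (j, i) \in graph_filling g]| == 1].
  apply/forallP=> i; rewrite (_ : [set j | _] = [set g i]) ?cards1 //.
  by apply/setP=> j; rewrite !inE eq_sym.
have colE (j : 'I_n) : [set i | (j, i) \in graph_filling g] = [set i | g i == j].
  by apply/setP=> i; rewrite !inE.
rewrite /=; apply/andP/forallP => [[/forallP gcol /forall_inP gbox] c | gP].
  rewrite -colE gcol; apply/forall_inP=> i; rewrite inE => gi.
  by have := gbox _ gi.
split; first by apply/forallP=> j; rewrite colE; case/andP: (gP j).
apply/forall_inP=> [[c i]]; rewrite inE /= => gi.
by have /andP[_ /forall_inP] := gP c; apply; rewrite inE.
Qed.

Lemma sum_tableaux n :
  \sum_(T : tableau n.+1) t ^+ fr T =
  \sum_(g : {ffun 'I_n.+1.*2 -> 'I_n.+1})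
     \prod_(c < n.+1) tableau_weight t c [set i | g i == c].
Proof.
pose F (T : filling n.+1) := t ^+ #|[set b in T | free_box b]|.
transitivity (\sum_(T | is_tableau T) F T); first exact/esym/big_sub.
(* The default [ord0] is never reached on a tableau, where every row has a dot. *)
pose rowdot (T : filling n.+1) := [ffun i => odflt ord0 [pick j | (j, i) \in T]].
have rowdotK g : rowdot (graph_filling g) = g.
  apply/ffunP=> i; rewrite ffunE; case: pickP => [j|/(_ (g i))]; rewrite inE /=.
    by move/eqP.
  by rewrite eqxx.
rewrite (reindex_onto (@graph_filling n.+1) rowdot) => [|T]; last first.
  case/and4P=> _ /forallP rowT _ _; apply/setP=> [[j i]]; rewrite inE ffunE /=.
  have /cards1P[j0 /setP rowE] := rowT i.
  have {}rowE j' : ((j', i) \in T) = (j' == j0) by have := rowE j'; rewrite !inE.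
  case: pickP => [j'|/(_ j0)]; rewrite rowE; last by rewrite eqxx.
  by move/eqP=> ->; rewrite rowE eq_sym.
rewrite big_mkcond; apply: eq_bigr => g _.
rewrite rowdotK eqxx andbT is_tableau_graph; case: ifP => [/forallP gP | /negbT].
  transitivity (\prod_(c < n.+1) t ^+ #|[set i | g i == c] :&: top n.+1 c.+1|).
    rewrite prodrXr; congr (_ ^+ _); rewrite -sum1dep_card /=.
    rewrite (eq_bigl (fun b : 'I_n.+1 * 'I_n.+1.*2 => (g b.2 == b.1) && (n.+1.*2 <= b.2 + b.1.+1)%N)).
      rewrite -(pair_big_dep xpredT (fun c i => (g i == c) && (n.+1.*2 <= i + c.+1)%N) (fun _ _ => 1%N)).
      apply: eq_bigr => c _; rewrite sum1dep_card; apply: eq_card => i.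
      by rewrite !inE.
    by move=> b; rewrite !inE /free_box /pos; congr (_ && _); apply/idP/idP; lia.
  by apply: eq_bigr => c _; rewrite /tableau_weight gP.
rewrite negb_forall => /existsP[c /negPf cbad].
by rewrite (bigD1 c) //= /tableau_weight cbad mul0r.
Qed.

(** Since f(j) >= j, the index 2k+1 is the largest that the fiber can contain, so any second element
    lies before it. *)
Lemma doubled_fixed_point_fiber n (f : surjective_pistol n) (k : 'I_n) :
  doubled_fixed_point f (even_pos k) =
  [&& k.+1 < n, [exists i in [set i | val f i == k], val i == k.*2.+1]
    & 1 < #|[set i | val f i == k]|]%N.
Proof.
have f_ge (i : 'I_n.*2) : val f i == k -> (i < k.*2.+2)%N.
  by case/andP: (valP f) => _ /forallP/(_ i) f_i /eqP fi; rewrite fi in f_i.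
have even_posI (j : 'I_n) : (even_pos j == even_pos k) = (j == k).
  by rewrite /even_pos /pos -val_eqE /=; lia.
rewrite /doubled_fixed_point (_ : (1 <= even_pos k <= n.*2 - 2)%N = (k.+1 < n)%N); last first.
  by rewrite /even_pos /pos; have := ltn_ord k; lia.
congr (_ && _); apply/existsP/andP => [[j /existsP[j' /and4P[]]]|[]].
  rewrite /pistol_value !even_posI => /eqP jk lt_j'j f_j' f_j; split.
    apply/exists_inP; exists j; first by rewrite inE.
    by move: jk; rewrite /even_pos /pos /=; lia.
  rewrite (cardsD1 j) inE f_j ltnS; apply/card_gt0P; exists j'.
  by rewrite !inE f_j' andbT -val_eqE; move: lt_j'j; rewrite /pos /=; lia.
case/exists_inP=> j; rewrite inE => f_j jk.
rewrite (cardsD1 j) inE f_j ltnS => /card_gt0P[j']; rewrite !inE -val_eqE => /andP[ne f_j'].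
exists j; apply/existsP; exists j'; rewrite /pistol_value !even_posI f_j f_j' !andbT.
by move: jk ne (f_ge _ f_j'); rewrite /even_pos /pos /=; lia.
Qed.

Lemma sum_pistols n :
  \sum_(f : surjective_pistol n) t ^+ ndf f =
  \sum_(g : {ffun 'I_n.*2 -> 'I_n})
     \prod_(k < n) pistol_weight t k [set i | g i == k].
Proof.
pose F (g : {ffun 'I_n.*2 -> 'I_n}) := \prod_(k < n) pistol_weight t k [set i | g i == k].
transitivity (\sum_(f : surjective_pistol n) F (val f)).
  apply: eq_bigr => f _; rewrite /ndf -sum1dep_card -prodrXr big_mkcond.
  apply: eq_bigr => k _; rewrite doubled_fixed_point_fiber /pistol_weight.
  have /andP[/forallP/(_ k)/existsP[j fj] /forallP f_ge] := valP f.
  rewrite if_neg [RHS]ifT //.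
  apply/andP; split; first by apply/set0Pn; exists j; rewrite inE.
  apply/forall_inP=> i; rewrite inE => /eqP fi.
  by have := f_ge i; rewrite fi.
transitivity (\sum_(g | is_surjective_pistol g) F g); first exact/esym/big_sub.
rewrite big_mkcond; apply: eq_bigr => g _; case: ifP => // /negbT.
rewrite negb_and => /orP[|]; rewrite negb_forall => /existsP.
  case=> k; rewrite negb_exists => /forallP gk.
  rewrite /F (bigD1 k) //= /pistol_weight (_ : [set i | _] = set0) ?eqxx ?mul0r //.
  by apply/setP=> i; rewrite !inE; apply/negbTE.
case=> i gi; rewrite /F (bigD1 (g i)) //= /pistol_weight andbC.
rewrite (_ : [forall i0 in _, _] = false) ?mul0r //.
apply/negbTE; rewrite negb_forall; apply/existsP; exists i.
by rewrite inE eqxx.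
Qed.

End GeneratingFunctions.

(** * Evaluation of both sums and construction of the map *)

Lemma tableau_generating_function m :
  \sum_(T : tableau m.+1) 'X ^+ fr T = tableau_sums m 0.
Proof.
rewrite sum_tableaux (@sum_prod_fibers _ _ (@tableau_weight _ 'X m.+1) _ (rev (iota 0 m.+1))).
  rewrite wsum_tableau_weight // ?cardsT ?card_ord //; last by move=> i _; rewrite inE.
  rewrite setDT -completion_sum_set0 completion_sum_weighted_pairs /weighted_pairs.
  (* The two weighted pairs have coefficients C(1,2) = 0 and C(2,2) = 1, so only [paired_sums] at 0
     remains. *)
  by rewrite bin_small // binn mul0r add0r mul1r paired_sumsE.
by rewrite perm_rev.
Qed.

Lemma pistol_generating_function m :
  4 ^+ m * (\sum_(f : surjective_pistol m.+1) 'X ^+ ndf f) = pistol_diffs m 0.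
Proof.
rewrite sum_pistols (@sum_prod_fibers _ _ (@pistol_weight _ 'X m.+1) _ (iota 0 m.+1)) //.
rewrite wsum_pistol_weight // => [|i _]; last by rewrite inE.
rewrite /pistol_diffs /= -[2%N]/(1.*2) iter_dstep_double; congr (_ * _).
(* At the start exactly two arguments are pending, so x has exponent 0 and the iteration begins with
   the constant X. *)
apply: eq_iter_shift_step => x; rewrite (_ : [set i in _ | _] = [set i : 'I_m.+1.*2 | i < 2]%N).
  by rewrite card_low // mulr1.
by apply/setP=> i; rewrite !inE.
Qed.

(** Supplies the default bin for [packing]: the pistol taking each value 2(k+1) at 2k+1 and 2k+2. *)
Lemma surjective_pistol_inhabited n : inhabited (surjective_pistol n).
Proof.
have lt_half (i : 'I_n.*2) : (i./2 < n)%N by have := ltn_ord i; lia.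
have fP : is_surjective_pistol [ffun i => Ordinal (lt_half i)].
  apply/andP; split; apply/forallP=> k.
    have lt_k : (k.*2 < n.*2)%N by rewrite ltn_double.
    by apply/existsP; exists (Ordinal lt_k); rewrite ffunE -val_eqE /= doubleK.
  by rewrite ffunE /even_pos /pos /=; lia.
exact: inhabits (exist (fun f => is_surjective_pistol f) _ fP).
Qed.

Local Close Scope ring_scope.

Theorem theorem6 (n : nat) (n_ge1 : 1 <= n) :
  exists phi : tableau n -> surjective_pistol n,
    (forall f : surjective_pistol n, exists T : tableau n, phi T = f) /\
    (forall f : surjective_pistol n,
       \sum_(T : tableau n | phi T == f) 2 ^ fr T = 2 ^ ndf f).
Proof.
case: n n_ge1 => // m _; have [f0] := surjective_pistol_inhabited m.+1.
have [Q Q_ge0 defQ] := tableau_sums_refine m 0.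
have [||phi phiE] := @packing _ _ (@fr m.+1) f0 (@ndf m.+1) (4 ^ m) Q _ Q_ge0.
- by rewrite expn_gt0.
- by rewrite -defQ -pistol_generating_function -tableau_generating_function
    natrX -GRing.mulrBr.
(* Surjectivity is a consequence of the sums: an empty fiber would give 0, which is not a power of
   2. *)
exists phi; split=> // f; have [T /eqP phiT | nophi] := pickP (fun T => phi T == f).
  by exists T.
by have := phiE f; rewrite big_pred0 // => /esym/eqP; rewrite expn_eq0.
Qed.
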